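(* Let $N\ge 2$ and let $\mathcal{M}$ be the real vector space of $N\times N$ real matrices $A$ with $A^{t}=-A$ and $A\mathbf{1}=0$. For $1\le i\le N-2$ and $1\le j\le N-(i+1)$ let $M_{i,i+1,i+1+j}$ be the $N\times N$ cycle matrix with entries $$(M_{i,i+1,i+1+j})_{mn}=\begin{cases}1 & \text{if }(m,n)\in\{(i,i+1),(i+1,i+1+j),(i+1+j,i)\},\\ -1 & \text{if }(m,n)\in\{(i+1,i),(i+1+j,i+1),(i,i+1+j)\},\\ 0 & \text{otherwise.}\end{cases}$$ Then the set $\{M_{i,i+1,i+1+j}: 1\le i\le N-2,\ 1\le j\le N-(i+1)\}$ is a basis of $\mathcal{M}$. Hence, if a continuous-time Markov chain on $S=\{1,\dots,N\}$ has infinitesimal generator $Q$ with $q_{ij}>0$ for all $i\ne j$ and invariant distribution $\pi$, and $\Pi=\operatorname{diag}(\pi_1,\dots,\pi_N)$, then there are real numbers $d_{i,i+1,i+1+j}$ such that $$\Pi Q-(\Pi Q)^{t}=\sum_{i=1}^{N-2}\sum_{j=1}^{N-(i+1)} d_{i,i+1,i+1+j}\,M_{i,i+1,i+1+j}.$$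
   Context: $\mathbf{1}=(1,\dots,1)^{t}\in\mathbb{R}^N$. An infinitesimal generator $Q=(q_{ij})$ on $S$ is a real matrix with $q_{ij}\ge 0$ for $i\neq j$ and $q_{ii}=-\sum_{j\ne i}q_{ij}$. A probability distribution $\pi=(\pi_1,\dots,\pi_N)$ (row vector) is invariant if $\pi Q=0$. *)

(* Defs.v *)
From mathcomp Require Import all_boot all_order all_algebra.
From mathcomp Require Import reals.

Set Implicit Arguments.
Unset Strict Implicit.
Unset Printing Implicit Defensive.

Import Order.TTheory GRing.Theory Num.Theory.
Local Open Scope ring_scope.

(* States are labelled 1, ..., N: the label of the index m : 'I_N is m.+1. *)

(* The subspace {A | A^T = - A /\ A *m 1 = 0}, see [mem_skew_null]. *)
Definition skew_null (R : realType) (N : nat) : {vspace 'M[R]_N} :=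
  (lker (linfun (@trmx R N N) + \1%VF)%R :&:
   lker (linfun (mulmxr (const_mx 1 : 'cV[R]_N) : 'M[R]_N -> 'cV[R]_N)))%VS.

Lemma mem_skew_null (R : realType) (N : nat) (A : 'M[R]_N) :
  A \in skew_null R N <-> A^T = - A /\ A *m (const_mx 1 : 'cV[R]_N) = 0.
Proof.
rewrite /skew_null memv_cap !memv_ker add_lfunE id_lfunE !lfunE /= addr_eq0.
by split=> [/andP[/eqP-> /eqP->]|[-> ->]]; rewrite ?eqxx.
Qed.

(* The cycle a -> b -> c -> a on labels, not on indices. *)
Definition cycle_mx (R : realType) (N a b c : nat) : 'M[R]_N :=
  \matrix_(m < N, n < N)
    if (m.+1, n.+1) \in [:: (a, b); (b, c); (c, a)] then 1
    else if (m.+1, n.+1) \in [:: (b, a); (c, b); (a, c)] then -1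
    else 0.

Definition cycle_mxs (R : realType) (N : nat) : seq 'M[R]_N :=
  [seq cycle_mx R N i i.+1 (i.+1 + j) |
     i <- iota 1 (N - 2), j <- iota 1 (N - i.+1)].

Definition is_generator (R : realType) (N : nat) (Q : 'M[R]_N) : Prop :=
  (forall i j, i != j -> 0 <= Q i j) /\
  (forall i, Q i i = - \sum_(j < N | j != i) Q i j).

Definition is_distribution (R : realType) (N : nat) (p : 'rV[R]_N) : Prop :=
  (forall i, 0 <= p 0 i) /\ \sum_(i < N) p 0 i = 1.

Definition is_invariant (R : realType) (N : nat) (Q : 'M[R]_N)
  (p : 'rV[R]_N) : Prop :=
  is_distribution p /\ p *m Q = 0.

(* Main.v *)
(** The functional [label_colsum i k], minus the sum of the entries of column
    [k] in rows [1, ..., i], satisfies for [i + 2 <= k] a biorthogonality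
    relation: it is [1] on [M_(i,i+1,k)] and [0] on every other cycle matrix of
    the family.  This gives freeness.  If all these functionals vanish at a
    skew matrix, the matrix is tridiagonal; zero row sums then kill it, row
    after row.  Hence every [A] in the space equals
    [\sum_(i,k) label_colsum i k A *: M_(i,i+1,k)]. *)

Require Import Defs.
From HB Require Import structures.
From mathcomp Require Import all_boot all_order all_algebra.
From mathcomp Require Import reals.
From mathcomp Require Import zify ring.

Set Implicit Arguments.
Unset Strict Implicit.
Unset Printing Implicit Defensive.

Import Order.TTheory GRing.Theory Num.Theory.
Local Open Scope ring_scope.

Section Biorthogonal.

Variables (K : fieldType) (V : vectType K) (I : eqType).
Variables (f : I -> V) (phi : I -> {scalar V}).

Lemma biorthogonal_sum (s : seq I) (c : I -> K) (x : I) :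
    uniq s -> x \in s ->
    {in s &, forall i j, phi i (f j) = (i == j)%:R} ->
  phi x (\sum_(y <- s) c y *: f y) = c x.
Proof.
move=> s_uniq xs phif; rewrite linear_sum (bigD1_seq x) //= linearZ /= phif //.
rewrite eqxx mulr1 big_seq_cond big1 ?addr0 // => y /andP[ys yx].
by rewrite linearZ /= phif // eq_sym (negbTE yx) mulr0.
Qed.

(** If [f x] lay in the span of the later vectors, [phi x], which kills each of them, would kill
    [f x] too; but [phi x (f x)] is 1. *)
Lemma biorthogonal_free (s : seq I) :
    uniq s -> {in s &, forall i j, phi i (f j) = (i == j)%:R} ->
  free (map f s).
Proof.
elim: s => [|x s IHs] /=; first by rewrite nil_free.
move=> /andP[xs s_uniq] phif; rewrite free_cons IHs // ?andbT; last first.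
  by move=> i j iS jS; rewrite phif // inE ?iS ?jS orbT.
apply/negP => fx; have: f x \in lker (linfun (phi x : V -> K^o)).
  apply: subvP fx; apply/span_subvP => _ /mapP[y ys ->].
  rewrite memv_ker lfunE /= phif ?inE ?eqxx ?ys ?orbT //.
  by have [xy|//] := eqVneq x y; rewrite xy ys in xs.
by rewrite memv_ker lfunE /= phif ?inE ?eqxx //= oner_eq0.
Qed.

End Biorthogonal.

Section CycleMatrices.

Variables (R : realType) (N : nat).
Implicit Types (A : 'M[R]_N) (a b c i k : nat).

(** The inner sum picks the column labelled [k], so [k] can range over [nat]. The sign offsets the
    entry -1 of M_(i,i+1,k) at (i, k). *)
Definition label_colsum i k A : R :=
  - \sum_(l < N | (l < i)%N) \sum_(m < N | m.+1 == k) A l m.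

Lemma label_colsum_is_scalar i k : scalar (label_colsum i k).
Proof.
move=> x A B; rewrite /label_colsum mulrN -opprD mulr_sumr -big_split /=.
congr (- _); apply: eq_bigr => l _; rewrite mulr_sumr -big_split /=.
by apply: eq_bigr => m _; rewrite !mxE.
Qed.

HB.instance Definition _ i k :=
  GRing.isLinear.Build R 'M[R]_N R _ (label_colsum i k)
    (label_colsum_is_scalar i k).

Lemma label_colsumE i (m : 'I_N) A :
  label_colsum i m.+1 A = - \sum_(l < N | (l < i)%N) A l m.
Proof.
congr (- _); apply: eq_bigr => l _; rewrite (bigD1 m) //= big1 ?addr0 // => n.
by rewrite eqSS => /andP[/eqP/val_inj->]; rewrite eqxx.
Qed.

Lemma sum_label_eq i b : (0 < b <= N)%N ->
  \sum_(n < N | (n < i)%N) (n.+1 == b)%:R = (b <= i)%:R :> R.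
Proof.
case: b => // b bN; rewrite big_mkcond (bigD1 (Ordinal bN)) //= eqxx big1.
  by rewrite addr0; case: ltnP.
by move=> n; rewrite -val_eqE /= eqSS => /negbTE->; case: ifP.
Qed.

(** Distinct labels make the cases of the definition disjoint. In this form skewness is a [ring]
    identity and sums of entries reduce to sums of indicators. *)
Lemma cycle_mxE a b c (m n : 'I_N) : a != b -> b != c -> a != c ->
  cycle_mx R N a b c m n =
    (m.+1 == a)%:R * ((n.+1 == b)%:R - (n.+1 == c)%:R)
  + (m.+1 == b)%:R * ((n.+1 == c)%:R - (n.+1 == a)%:R)
  + (m.+1 == c)%:R * ((n.+1 == a)%:R - (n.+1 == b)%:R).
Proof.
move=> ab bc ac; rewrite mxE !inE !xpair_eqE.
move: (m.+1) (n.+1) => {}m {}n.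
have [ma|_] := eqVneq m a.
  rewrite ma (negbTE ab) (negbTE ac) /=.
  have [nb|_] := eqVneq n b; first by rewrite nb (negbTE bc) /=; ring.
  by case: (n == c) => /=; ring.
have [mb|_] := eqVneq m b.
  rewrite mb (negbTE bc) /=.
  have [nc|_] := eqVneq n c; first by rewrite nc eq_sym (negbTE ac) /=; ring.
  by case: (n == a) => /=; ring.
have [_|_] /= := eqVneq m c; last by ring.
have [na|_] := eqVneq n a; first by rewrite na (negbTE ab) /=; ring.
by case: (n == b) => /=; ring.
Qed.

Lemma cycle_mx_skew_null a b c :
    a != b -> b != c -> a != c ->
    (0 < a <= N)%N -> (0 < b <= N)%N -> (0 < c <= N)%N ->
  cycle_mx R N a b c \in skew_null R N.
Proof.
move=> ab bc ac aN bN cN; apply/mem_skew_null; split.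
  by apply/matrixP => m n; rewrite [RHS]mxE mxE !cycle_mxE //; ring.
have sum1 x : (0 < x <= N)%N -> \sum_(n < N) (n.+1 == x)%:R = 1 :> R.
  move=> xN; have /andP[_ xleN] := xN; have := sum_label_eq N xN.
  by rewrite xleN; under eq_bigl do rewrite ltn_ord.
apply/matrixP => m z; rewrite !mxE.
under eq_bigr do rewrite cycle_mxE // mxE mulr1.
by rewrite !big_split /= -!mulr_sumr !sumrB !sum1 //; ring.
Qed.

(** Column c of M_(a,a+1,c) has -1 in row a and +1 in the very next row, so its partial sum down to
    row i is nonzero only for i = a. *)
Lemma label_colsum_cycle_mx i k a c :
    (i.+1 < k <= N)%N -> (0 < a)%N -> (a.+1 < c <= N)%N ->
  label_colsum i k (cycle_mx R N a a.+1 c) = ((i == a) && (k == c))%:R.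
Proof.
case: k => [|k] //= /andP[ik kN] a0 /andP[ac cN].
rewrite (label_colsumE i (Ordinal kN)).
rewrite (eq_bigr (fun l : 'I_N =>
    (k.+1 == c)%:R * ((l.+1 == a.+1)%:R - (l.+1 == a)%:R))); last first.
  move=> l li; rewrite cycle_mxE /=; [|lia..].
  (* The row label is at most [i] and the column label at least [i + 2], whereas these four
     positions lie on the superdiagonal or below the diagonal. *)
  have lak : (l.+1 == a) && (k.+1 == a.+1) = false by lia.
  have lbk : (l.+1 == a.+1) && (k.+1 == a) = false by lia.
  have lck : (l.+1 == c) && (k.+1 == a) = false by lia.
  have lck' : (l.+1 == c) && (k.+1 == a.+1) = false by lia.
  rewrite !mulrBr -!natrM !mulnb lak lbk lck lck' sub0r !subr0 addr0 addrC.
  by rewrite ![(k.+1 == c) && _]andbC.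
rewrite -mulr_sumr sumrB !sum_label_eq; [|lia..].
have [->|ia] := eqVneq i a; first by rewrite leqnn ltnn sub0r mulrN1 opprK.
by rewrite [(a <= i)%N]leq_eqVlt [a == i]eq_sym (negbTE ia) subrr mulr0 oppr0.
Qed.

Lemma skew_null_eq0 A : A \in skew_null R N ->
    (forall i k, (0 < i)%N -> (i.+1 < k <= N)%N -> label_colsum i k A = 0) ->
  A = 0.
Proof.
move=> /mem_skew_null[Askew Arow] colA.
have skewA l m : A m l = - A l m by have /matrixP/(_ l m) := Askew; rewrite !mxE.
have far (l m : 'I_N) : (l.+1 < m)%N -> A l m = 0.
  move=> lm.
  have c0 i : (i < m)%N -> \sum_(n < N | (n < i)%N) A n m = 0.
    case: i => [|i] im; first by rewrite big_pred0.
    apply/eqP; rewrite -oppr_eq0 -label_colsumE colA //.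
    by rewrite ltnS im ltn_ord.
  (* The sums of column [m] over the rows up to [l] and over the rows before [l] both vanish; their
     difference is [A l m]. For [l = 0] the second sum is empty. *)
  have := c0 l.+1 lm; rewrite (bigD1 l) //= => <-; rewrite -[LHS]addr0.
  congr (_ + _); rewrite -[LHS](c0 l (ltnW lm)); apply: eq_bigl => n.
  by rewrite -val_eqE /=; lia.
have diag l : A l l = 0.
  by apply/eqP; have /eqP := skewA l l; rewrite -addr_eq0 -mulr2n mulrn_eq0.
(* Once the entries left of the diagonal vanish, the superdiagonal entry is the only one left in a
   row of sum zero. *)
have row_next (l m : 'I_N) : m = l.+1 :> nat ->
    (forall j : 'I_N, (j < l)%N -> A l j = 0) -> A l m = 0.
  move=> ml Aj; have /matrixP/(_ l (0 : 'I_1)) := Arow.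
  rewrite !mxE (bigD1 m) //= mxE mulr1 big1 ?addr0 // => j jm; rewrite mxE mulr1.
  have [lj|/Aj//|/val_inj <-] := ltngtP l j; last exact: diag.
  by apply: far; move: jm; rewrite -val_eqE /=; lia.
(* By skewness, the entries left of the diagonal in row [n.+1] come from column [n.+1]: row [n] is
   the induction hypothesis, earlier rows are [far]. *)
have near n : forall l m : 'I_N, l = n :> nat -> m = n.+1 :> nat -> A l m = 0.
  elim: n => [|n IHn] l m ln mn; apply: row_next => [|j jl]; try lia.
  rewrite skewA; have [jn|jn] := eqVneq (j : nat) n.
    by rewrite (IHn j l) ?oppr0.
  by rewrite far ?oppr0 //; lia.
have upper (l m : 'I_N) : (l < m)%N -> A l m = 0.
  by rewrite leq_eqVlt => /orP[/eqP lm|/far//]; apply: (near l).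
apply/matrixP => l m; rewrite mxE; have [lm|ml|lm] := ltngtP l m.
- exact: upper.
- by rewrite skewA upper ?oppr0.
- by rewrite (val_inj lm : l = m) diag.
Qed.

(** Same enumeration as [cycle_mxs], but storing the outer labels of each cycle, which also index
    its dual functional. *)
Definition cycle_labels : seq (nat * nat) :=
  [seq (i, i.+1 + j)%N | i <- iota 1 (N - 2), j <- iota 1 (N - i.+1)].

Lemma mem_cycle_labels i k :
  ((i, k) \in cycle_labels) = (0 < i)%N && (i.+1 < k <= N)%N.
Proof.
apply/allpairsPdep/idP => [[x [j [+ + [-> ->]]]]|ik].
  by rewrite !mem_iota; lia.
by exists i, (k - i.+1)%N; rewrite !mem_iota; split; [lia..|congr (_, _); lia].
Qed.

Lemma cycle_labels_uniq : uniq cycle_labels.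
Proof.
apply: allpairs_uniq_dep => [|i _|]; rewrite ?iota_uniq //.
by move=> [i j] [i' j'] _ _ /= [-> /addnI->].
Qed.

Lemma cycle_mxsE :
  cycle_mxs R N = [seq cycle_mx R N p.1 p.1.+1 p.2 | p <- cycle_labels].
Proof. by rewrite /cycle_labels map_allpairs. Qed.

Lemma label_colsum_biorthogonal :
  {in cycle_labels &, forall p q,
    label_colsum p.1 p.2 (cycle_mx R N q.1 q.1.+1 q.2) = (p == q)%:R}.
Proof.
move=> [i k] [a c]; rewrite !mem_cycle_labels => /andP[_ ik] /andP[a0 ac].
exact: label_colsum_cycle_mx.
Qed.

Lemma cycle_mxs_skew_null p : p \in cycle_labels ->
  cycle_mx R N p.1 p.1.+1 p.2 \in skew_null R N.
Proof.
case: p => i k; rewrite mem_cycle_labels /= => ik.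
by apply: cycle_mx_skew_null; lia.
Qed.

(** The difference of the two sides stays in the space, and by biorthogonality every functional
    vanishes on it. *)
Lemma skew_null_expansion A : A \in skew_null R N ->
  A = \sum_(p <- cycle_labels)
        label_colsum p.1 p.2 A *: cycle_mx R N p.1 p.1.+1 p.2.
Proof.
move=> As; apply/eqP; rewrite -subr_eq0; apply/eqP/skew_null_eq0.
  rewrite rpredB // big_seq rpred_sum // => p ps.
  by rewrite rpredZ // cycle_mxs_skew_null.
move=> i k i0 ik; rewrite linearB /=.
rewrite (@biorthogonal_sum _ _ _ _
  (fun p => label_colsum p.1 p.2 : {scalar _}) _ _ (i, k)) ?subrr //.
- exact: cycle_labels_uniq.
- by rewrite mem_cycle_labels i0.
- exact: label_colsum_biorthogonal.
Qed.

Lemma cycle_mxs_basis : basis_of (skew_null R N) (cycle_mxs R N).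
Proof.
rewrite cycle_mxsE /basis_of.
rewrite (@biorthogonal_free _ _ _ _
  (fun p => label_colsum p.1 p.2 : {scalar _})) ?andbT; last 2 first.
- exact: cycle_labels_uniq.
- exact: label_colsum_biorthogonal.
rewrite eqEsubv; apply/andP; split.
  by apply/span_subvP => _ /mapP[p /cycle_mxs_skew_null ps ->].
apply/subvP => A /skew_null_expansion->; rewrite big_seq rpred_sum // => p ps.
by apply/rpredZ/memv_span/mapP; exists p.
Qed.

(** Zero row sums of [Q] give ΠQ1 = 0; invariance gives (ΠQ)^t 1 = Q^t p^t = (pQ)^t = 0. *)
Lemma flux_skew_null (Q : 'M[R]_N) (p : 'rV[R]_N) :
    is_generator Q -> is_invariant Q p ->
  diag_mx p *m Q - (diag_mx p *m Q)^T \in skew_null R N.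
Proof.
move=> [_ Qdiag] [_ pQ]; apply/mem_skew_null; split.
  by rewrite linearB /= trmxK opprB.
have Q1 : Q *m (const_mx 1 : 'cV_N) = 0.
  apply/matrixP => i z; rewrite !mxE (bigD1 i) //= mxE mulr1 Qdiag.
  by under [X in _ + X]eq_bigr do rewrite mxE mulr1; rewrite addNr.
have diag1 : diag_mx p *m (const_mx 1 : 'cV_N) = p^T.
  by apply/matrixP => i z; rewrite mul_diag_mx !mxE mulr1 (ord1 z).
rewrite mulmxBl -mulmxA Q1 mulmx0 trmx_mul tr_diag_mx -mulmxA diag1 -trmx_mul.
by rewrite pQ trmx0 subrr.
Qed.

End CycleMatrices.

Theorem mainTheorem2 (R : realType) (N : nat) (hN : (2 <= N)%N) :
  basis_of (skew_null R N) (cycle_mxs R N) /\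
  (forall (Q : 'M[R]_N) (pi : 'rV[R]_N),
     is_generator Q ->
     (forall i j, i != j -> 0 < Q i j) ->
     is_invariant Q pi ->
     exists d : nat -> nat -> nat -> R,
       diag_mx pi *m Q - (diag_mx pi *m Q)^T =
       \sum_(1 <= i < (N - 2).+1) \sum_(1 <= j < (N - i.+1).+1)
         d i i.+1 (i.+1 + j)%N *: cycle_mx R N i i.+1 (i.+1 + j)).
Proof.
split; first exact: cycle_mxs_basis.
move=> Q pi genQ _ invQ; have As := flux_skew_null genQ invQ.
(* The middle label is always i + 1, so the outer two determine the coefficient. *)
exists (fun i _ k => label_colsum i k (diag_mx pi *m Q - (diag_mx pi *m Q)^T)).
rewrite {1}(skew_null_expansion As) /cycle_labels big_allpairs_dep.
rewrite /index_iota subn1; apply: eq_bigr => i _.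
by rewrite subn1.
Qed.
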